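(* The generating functions of the sequences $C_A, C_B, C_C, C_D$ are (A) $\displaystyle\sum_{n=0}^\infty C_A(n)\,x^n=\frac{162x^3-9x^2+24x-1}{(27x-1)(27x^2+1)}$; (B) $\displaystyle\sum_{n=0}^\infty C_B(n)\,x^n=\frac{6x\,(27x^2+12x-1)}{(27x-1)(27x^2+1)}$; (C) $\displaystyle\sum_{n=0}^\infty C_C(n)\,x^n=\frac{18x^2\,(5-9x)}{(1-27x)(1+27x^2)}$; (D) $\displaystyle\sum_{n=0}^\infty C_D(n)\,x^n=\frac{18x}{1-27x}$.
   Context: For nonnegative integers $p_1,p_2,p_3$ with $P=p_1+p_2+p_3$, $\binom{P}{p_1,p_2,p_3}=\frac{P!}{p_1!\,p_2!\,p_3!}$ is the trinomial coefficient. All sums below run over triples $(k_1,k_2,k_3)$ of nonnegative integers with the indicated sum (an empty sum is $0$). Define $$C_A(n)=\sum_{k_1+k_2+k_3=n}\binom{3n}{3k_1,\,3k_2,\,3k_3}\quad (n\geq 0),$$ $$C_B(n)=\sum_{k_1+k_2+k_3=n-1}\binom{3n}{3k_1+1,\,3k_2+1,\,3k_3+1}\quad (n\geq 1),\qquad C_B(0)=0,$$ $$C_C(n)=\sum_{k_1+k_2+k_3=n-2}\binom{3n}{3k_1+2,\,3k_2+2,\,3k_3+2}\quad (n\geq 1),\qquad C_C(0)=0,$$ $$C_D(n)=6\sum_{k_1+k_2+k_3=n-1}\binom{3n}{3k_1,\,3k_2+1,\,3k_3+2}\quad (n\geq 1),\qquad C_D(0)=0.$$ Generating functions are understood as formal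 power series in $x$; the denominators have nonzero constant term and are therefore invertible. *)

(* Defs.v *)
From HB Require Import structures.
From mathcomp Require Import all_boot all_order all_algebra.
From mathcomp Require Import boolp.

Set Implicit Arguments.
Unset Strict Implicit.
Unset Printing Implicit Defensive.

Import GRing.Theory.
Local Open Scope ring_scope.

(* Formal power series over R, given by their coefficient sequence.  They form
   a commutative unit ring whose units are the series with unit constant term. *)
Record fps (R : Type) := Fps { fps_coef :> nat -> R }.

Lemma fpsP (R : Type) (f g : fps R) : (forall n, f n = g n) -> f = g.
Proof. by case: f g => [f] [g] /= /funext ->. Qed.

HB.instance Definition _ (R : Type) := gen_eqMixin (fps R).
HB.instance Definition _ (R : Type) := gen_choiceMixin (fps R).

Section FpsZmodule.
Context (R : zmodType).
Implicit Types f g h : fps R.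

Definition fps_zero : fps R := Fps (fun=> 0).
Definition fps_opp f : fps R := Fps (fun n => - f n).
Definition fps_add f g : fps R := Fps (fun n => f n + g n).

Fact fps_addA : associative fps_add.
Proof. by move=> f g h; apply: fpsP => n /=; rewrite addrA. Qed.
Fact fps_addC : commutative fps_add.
Proof. by move=> f g; apply: fpsP => n /=; rewrite addrC. Qed.
Fact fps_add0 : left_id fps_zero fps_add.
Proof. by move=> f; apply: fpsP => n /=; rewrite add0r. Qed.
Fact fps_addN : left_inverse fps_zero fps_opp fps_add.
Proof. by move=> f; apply: fpsP => n /=; rewrite addNr. Qed.

HB.instance Definition _ :=
  GRing.isZmodule.Build (fps R) fps_addA fps_addC fps_add0 fps_addN.

Lemma fps_coef0 n : (0 : fps R) n = 0. Proof. by []. Qed.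
Lemma fps_coefD f g n : (f + g) n = f n + g n. Proof. by []. Qed.
Lemma fps_coefN f n : (- f) n = - f n. Proof. by []. Qed.
Lemma fps_coef_sum (I : Type) (r : seq I) (P : pred I) (F : I -> fps R) n :
  (\sum_(i <- r | P i) F i) n = \sum_(i <- r | P i) F i n.
Proof. exact: (big_morph (fun f : fps R => f n)). Qed.

End FpsZmodule.

Section FpsRing.
Context (R : comNzRingType).
Implicit Types f g h : fps R.

Definition fps_one : fps R := Fps (fun n => (n == 0%N)%:R).
Definition fps_mul f g : fps R :=
  Fps (fun n => \sum_(i < n.+1) f i * g (n - i)%N).

Let trunc m f : {poly R} := \poly_(i < m.+1) f i.

Let coef_trunc m f i : (i <= m)%N -> (trunc m f)`_i = f i.
Proof. by move=> le_im; rewrite coef_poly ltnS le_im. Qed.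

Let fps_mulE m f g n : (n <= m)%N ->
  fps_mul f g n = (trunc m f * trunc m g)`_n.
Proof.
move=> le_nm; rewrite coefM; apply: eq_bigr => i _.
by rewrite !coef_trunc ?(leq_trans _ le_nm) ?leq_subr // -ltnS.
Qed.

Fact fps_mulC : commutative fps_mul.
Proof.
by move=> f g; apply: fpsP => n; rewrite !(fps_mulE _ _ (leqnn n)) mulrC.
Qed.
Fact fps_mulA : associative fps_mul.
Proof.
move=> f g h; apply: fpsP => n.
transitivity ((trunc n f * (trunc n g * trunc n h))`_n).
  rewrite coefM; apply: eq_bigr => i _.
  by rewrite coef_trunc -1?ltnS // (fps_mulE _ _ (leq_subr i n)).
rewrite mulrA coefM; apply: eq_bigr => i _.
by rewrite coef_trunc ?leq_subr // -(fps_mulE f g) // -ltnS.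
Qed.
Fact fps_mul1 : left_id fps_one fps_mul.
Proof.
move=> f; apply: fpsP => n /=; rewrite big_ord_recl /= mul1r subn0 big1 ?addr0 //.
by move=> i _; rewrite mul0r.
Qed.
Fact fps_mulDl : left_distributive fps_mul +%R.
Proof.
move=> f g h; apply: fpsP => n; rewrite fps_coefD /= -big_split /=.
by apply: eq_bigr => i _; rewrite mulrDl.
Qed.
Fact fps_one_neq0 : fps_one != 0.
Proof.
apply/eqP => /(congr1 (fun f : fps R => f 0%N)) /= /eqP.
by rewrite oner_eq0.
Qed.

HB.instance Definition _ := GRing.Zmodule_isComNzRing.Build (fps R)
  fps_mulA fps_mulC fps_mul1 fps_mulDl fps_one_neq0.

Lemma fps_coef1 n : (1 : fps R) n = (n == 0%N)%:R. Proof. by []. Qed.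
Lemma fps_coefM f g n : (f * g) n = \sum_(i < n.+1) f i * g (n - i)%N.
Proof. by []. Qed.
Lemma fps_coefM0 f g : (f * g) 0%N = f 0%N * g 0%N.
Proof. by rewrite fps_coefM big_ord1. Qed.

Lemma fps_coefX_lt f k n : f 0%N = 0 -> (n < k)%N -> (f ^+ k) n = 0.
Proof.
move=> f0; elim: k n => // k IHk n lt_nk.
rewrite exprS fps_coefM big_ord_recl f0 mul0r add0r big1 // => i _.
rewrite IHk ?mulr0 //= /bump /= add1n.
case: n lt_nk i => [|n] lt_nk [i lti] //=.
by rewrite subSS (leq_ltn_trans (leq_subr _ _)).
Qed.

Definition fpsC (c : R) : fps R := Fps (fun n => if n == 0%N then c else 0).
Definition fpsX : fps R := Fps (fun n => (n == 1%N)%:R).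

Lemma fps_coefCM c f n : (fpsC c * f) n = c * f n.
Proof.
rewrite fps_coefM big_ord_recl /= subn0 big1 ?addr0 // => i _.
by rewrite mul0r.
Qed.

End FpsRing.

Section FpsUnitRing.
Context (R : comUnitRingType).
Implicit Types f g : fps R.

Definition fps_unit : {pred fps R} := fun f => f 0%N \is a GRing.unit.

(* If c is the constant term of f and h = 1 - c^-1 f, then f = c (1 - h) and
   f^-1 = c^-1 (1 + h + h^2 + ...); as h has no constant term, only the powers
   h^k with k <= n contribute to the n-th coefficient.  A series that is not
   invertible is mapped to itself, as required of a unitRingType. *)
Definition fps_inv f : fps R :=
  let h := 1 - fpsC (f 0%N)^-1 * f in
  if f \in fps_unit then
    Fps (fun n => (f 0%N)^-1 * \sum_(k < n.+1) (h ^+ k) n)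
  else f.

Fact fps_mulVx : {in fps_unit, left_inverse 1 fps_inv *%R}.
Proof.
move=> f uf; rewrite mulrC /fps_inv uf; set h := 1 - _.
have h0 : h 0%N = 0.
  by rewrite /h fps_coefD fps_coefN fps_coefCM mulVr ?subrr.
apply: fpsP => n; rewrite fps_coefM /=.
transitivity ((fpsC (f 0%N)^-1 * f * \sum_(k < n.+1) h ^+ k) n).
  rewrite fps_coefM; apply: eq_bigr => i _.
  rewrite fps_coefCM fps_coef_sum mulrCA mulrA; congr (_ * _).
  rewrite [in RHS](big_ord_widen_cond _ xpredT (fun k => (h ^+ k) (n - i)%N)
    (leqnn _)) [in LHS](big_ord_widen_cond n.+1 xpredT
    (fun k => (h ^+ k) (n - i)%N)) ?ltnS ?leq_subr //.
  rewrite [RHS](bigID (fun k : 'I__ => (k < (n - i).+1)%N)) /=.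
  rewrite [X in _ = _ + X]big1 ?addr0.
    by apply: eq_bigl => k; rewrite ltn_ord.
  by move=> k /andP[_]; rewrite -leqNgt => ?; rewrite fps_coefX_lt.
have -> : fpsC (f 0%N)^-1 * f = 1 - h by rewrite /h opprB addrC subrK.
by rewrite -opprB mulNr -subrX1 opprB fps_coefD fps_coefN fps_coefX_lt // subr0.
Qed.
Fact fps_unitPl f g : g * f = 1 -> fps_unit f.
Proof.
move=> /(congr1 (fun u : fps R => u 0%N)); rewrite fps_coefM0 /= => gf1.
by apply/unitrPr; exists (g 0%N); rewrite mulrC.
Qed.
Fact fps_inv_out : {in [predC fps_unit], fps_inv =1 id}.
Proof. by move=> f /negbTE nuf; rewrite /fps_inv; case: ifP => //; rewrite nuf. Qed.

HB.instance Definition _ := GRing.ComNzRing_hasMulInverse.Build (fps R)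
  fps_mulVx fps_unitPl fps_inv_out.

Lemma fps_unitE f : (f \is a GRing.unit) = (f 0%N \is a GRing.unit).
Proof. by []. Qed.

End FpsUnitRing.

Definition genfun (C : nat -> nat) : fps rat := Fps (fun n => (C n)%:R).

Local Open Scope nat_scope.

(* The upper index p1 + p2 + p3 is implicit; the division is exact. *)
Definition trinomial (p1 p2 p3 : nat) : nat :=
  (p1 + p2 + p3)`! %/ (p1`! * p2`! * p3`!).

(* In each sum the condition k1 + k2 + k3 = n - d is written
   k1 + k2 + k3 + d = n, so that the sum is empty when n < d (in particular
   for n = 0 when d > 0); it forces every ki to be at most n. *)
Definition CA (n : nat) : nat :=
  \sum_(k1 < n.+1) \sum_(k2 < n.+1) \sum_(k3 < n.+1 | k1 + k2 + k3 == n)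
    trinomial (3 * k1) (3 * k2) (3 * k3).

Definition CB (n : nat) : nat :=
  \sum_(k1 < n.+1) \sum_(k2 < n.+1) \sum_(k3 < n.+1 | k1 + k2 + k3 + 1 == n)
    trinomial (3 * k1 + 1) (3 * k2 + 1) (3 * k3 + 1).

Definition CC (n : nat) : nat :=
  \sum_(k1 < n.+1) \sum_(k2 < n.+1) \sum_(k3 < n.+1 | k1 + k2 + k3 + 2 == n)
    trinomial (3 * k1 + 2) (3 * k2 + 2) (3 * k3 + 2).

Definition CD (n : nat) : nat :=
  6 * \sum_(k1 < n.+1) \sum_(k2 < n.+1) \sum_(k3 < n.+1 | k1 + k2 + k3 + 1 == n)
    trinomial (3 * k1) (3 * k2 + 1) (3 * k3 + 2).

(* Main.v *)
Require Import Defs.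
From mathcomp Require Import all_boot all_order all_algebra.
From mathcomp Require Import zify ring.
Import GRing.Theory.

(** The four sequences count, among the words of length 3n in three letters,
those whose letter multiplicities lie in prescribed classes modulo 3.  Reading
letters one at a time moves a triple of multiplicities through (Z/3)^3, so the
counts evolve linearly, and three more letters give a recurrence from n to
n + 1.

A trinomial sum [tsum m F] weights F (i, j, k) by m! / (i! j! k!) over
i + j + k = m.  Pascal's rule says that raising m by one amounts to replacing
F by [shift F], the sum of its three unit translates ([tsumS]).  The four
sequences are the sums [tsum (3 * n) F] for F the indicator of the class
(0,0,0), (1,1,1) or (2,2,2), or of the union of the six permutations of
(0,1,2) ([tsum_cls], [CD_tsum]).  The span of these four indicators is stable
under the cube of [shift]: the coefficients are read off

  (X + Y + Z)^3 = (X^3 + Y^3 + Z^3) + 6 X Y Z + 3 (X^2 Y + five more terms)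

in the group algebra of (Z/3)^3, where X^3 = Y^3 = Z^3 = 1, multiplication by
X Y Z permutes the three diagonal classes cyclically, and the last six
monomials are the permutations of (0,1,2).

The recurrences become a linear system of size four for the generating
functions, with determinant (1 - 27x)(1 + 27x^2); Cramer's rule solves it
([linear_system]). *)

Local Open Scope nat_scope.

(** * Trinomial sums and the shift operator *)

Definition bsum (m : nat) (G : nat -> nat -> nat) : nat :=
  \sum_(i < m.+1) 'C(m, i) * G i (m - i).

Definition tsum (m : nat) (F : nat -> nat -> nat -> nat) : nat :=
  bsum m (fun i r => bsum r (F i)).

Definition shift (F : nat -> nat -> nat -> nat) (i j k : nat) : nat :=
  F i.+1 j k + F i j.+1 k + F i j k.+1.

Lemma eq_bsum m G H : (forall i r, G i r = H i r) -> bsum m G = bsum m H.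
Proof. by move=> eqGH; apply: eq_bigr => i _; rewrite eqGH. Qed.

Lemma bsumD m G H : bsum m (fun i r => G i r + H i r) = bsum m G + bsum m H.
Proof. by rewrite -big_split; apply: eq_bigr => i _; rewrite mulnDr. Qed.

Lemma bsumZ m c G : bsum m (fun i r => c * G i r) = c * bsum m G.
Proof. by rewrite /bsum big_distrr; apply: eq_bigr => i _; rewrite mulnCA. Qed.

(** Pascal's rule: the last of the m + 1 positions is either chosen or not. *)
Lemma bsumS m G :
  bsum m.+1 G = bsum m (fun i r => G i.+1 r) + bsum m (fun i r => G i r.+1).
Proof.
rewrite /bsum big_ord_recl bin0 subn0 /=.
under eq_bigr => i _ do rewrite /bump /= add1n binS subSS mulnDl.
rewrite big_split /= [X in _ + (X + _)]big_ord_recr /= bin_small // mul0n addn0.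
rewrite [X in _ = _ + X]big_ord_recl bin0 subn0 !mul1n addnA addnC.
congr (_ + (_ + _)); apply: eq_bigr => i _.
by rewrite /= /bump /= add1n subnSK.
Qed.

(** Binomial coefficients vanish above the diagonal, so the range of summation
may be taken independent of the upper index; this makes the nested sum in
[tsum] a sum over a box. *)
Lemma bsum_widen m K G : m < K ->
  bsum m G = \sum_(i < K) 'C(m, i) * G i (m - i).
Proof.
move=> ltmK; rewrite /bsum (big_ord_widen K (fun i => 'C(m, i) * G i (m - i))) //.
rewrite [RHS](bigID (fun i : 'I_K => i < m.+1)) /= [X in _ + X]big1 ?addn0 //.
by move=> i; rewrite -leqNgt => lt_mi; rewrite bin_small.
Qed.

Lemma eq_tsum m F G :
  (forall i j k, F i j k = G i j k) -> tsum m F = tsum m G.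
Proof. by move=> eqFG; do 2!apply: eq_bsum => ? ?; apply: eqFG. Qed.

Lemma tsumD m F G :
  tsum m (fun i j k => F i j k + G i j k) = tsum m F + tsum m G.
Proof. by rewrite -bsumD; apply: eq_bsum => i r; rewrite bsumD. Qed.

Lemma tsumZ m c F : tsum m (fun i j k => c * F i j k) = c * tsum m F.
Proof. by rewrite -bsumZ; apply: eq_bsum => i r; rewrite bsumZ. Qed.

Lemma tsum0 F : tsum 0 F = F 0 0 0.
Proof. by rewrite /tsum /bsum !big_ord1 !mul1n. Qed.

(** Pascal's rule used on both binomial layers: the additional letter is the
first one, or one of the other two. *)
Lemma tsumS m F : tsum m.+1 F = tsum m (shift F).
Proof.
rewrite /tsum bsumS -bsumD; apply: eq_bsum => i r.
by rewrite bsumS -!bsumD; apply: eq_bsum => j k; rewrite addnA.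
Qed.

(** Symmetry is inherited by induction from [shift], which commutes with
permutations of the three arguments. *)
Lemma tsum_swap12 m F : tsum m (fun i j k => F j i k) = tsum m F.
Proof.
elim: m F => [|m IHm] F; first by rewrite !tsum0.
rewrite !tsumS -[RHS]IHm; apply: eq_tsum => i j k.
by rewrite /shift [F j.+1 _ _ + _]addnC.
Qed.

Lemma tsum_swap23 m F : tsum m (fun i j k => F i k j) = tsum m F.
Proof.
elim: m F => [|m IHm] F; first by rewrite !tsum0.
by rewrite !tsumS -[RHS]IHm; apply: eq_tsum => i j k; rewrite /shift addnAC.
Qed.

Lemma trinomialE p q r : trinomial p q r = 'C(p + q + r, p) * 'C(q + r, q).
Proof.
rewrite /trinomial.
have -> : (p + q + r)`! = 'C(p + q + r, p) * 'C(q + r, q) * (p`! * q`! * r`!).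
  have le1 : p <= p + q + r by rewrite -addnA leq_addr.
  rewrite -(bin_fact le1) -addnA addKn -(bin_fact (leq_addr r q)) addKn; lia.
by rewrite mulnK ?muln_gt0 ?fact_gt0.
Qed.

(** * Residue classes modulo 3 *)

Definition cls (a b c i j k : nat) : nat :=
  (i %% 3 == a) * (j %% 3 == b) * (k %% 3 == c).

Definition cls012 (i j k : nat) : nat :=
  cls 0 1 2 i j k + cls 0 2 1 i j k + cls 1 0 2 i j k
  + cls 1 2 0 i j k + cls 2 0 1 i j k + cls 2 1 0 i j k.

(** Euclidean division by 3 as a reindexing. *)
Lemma sum_residue (a N : nat) (f : nat -> nat) : a < 3 ->
  \sum_(i < 3 * N) (i %% 3 == a) * f i = \sum_(k < N) f (3 * k + a).
Proof.
move=> lta3; elim: N => [|N IHN]; first by rewrite muln0 !big_ord0.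
rewrite [RHS]big_ord_recr -IHN mulnS addnC addn3 !big_ord_recr /= -!addnA.
congr (_ + _).
have -> : 3 * N %% 3 = 0 by lia.
have -> : (3 * N).+1 %% 3 = 1 by lia.
have -> : (3 * N).+2 %% 3 = 2 by lia.
case: a lta3 {IHN} => [|[|[|//]]] _; 
  by rewrite !mul1n ?mul0n ?addn0 ?add0n; congr f; lia.
Qed.

(** When a + b + c = 3d and i + j + k = 3n, writing i = 3k1 + a, j = 3k2 + b,
k = 3k3 + c turns the constraint into k1 + k2 + k3 + d = n.  Here k is
determined by i and j, so on the right the innermost sum has at most one
term. *)
Lemma tsum_cls a b c d n : a < 3 -> b < 3 -> c < 3 -> a + b + c = 3 * d ->
  tsum (3 * n) (cls a b c)
  = \sum_(k1 < n.+1) \sum_(k2 < n.+1) \sum_(k3 < n.+1 | k1 + k2 + k3 + d == n)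
      trinomial (3 * k1 + a) (3 * k2 + b) (3 * k3 + c).
Proof.
move=> lta ltb ltc abc; pose N := 3 * n.+1.
transitivity (\sum_(i < N) (i %% 3 == a) * \sum_(j < N) (j %% 3 == b) *
    ('C(3 * n, i) * 'C(3 * n - i, j) * ((3 * n - i - j) %% 3 == c))).
  rewrite /tsum (@bsum_widen _ N); last by rewrite /N; lia.
  apply: eq_bigr => i _; rewrite (@bsum_widen _ N); last by rewrite /N; lia.
  rewrite !big_distrr; apply: eq_bigr => j _; rewrite /cls /=; lia.
rewrite (@sum_residue a n.+1 (fun i => \sum_(j < N) (j %% 3 == b) *
    ('C(3 * n, i) * 'C(3 * n - i, j) * ((3 * n - i - j) %% 3 == c)))) //.
apply: eq_bigr => k1 _.
rewrite (@sum_residue b n.+1 (fun j => 'C(3 * n, 3 * k1 + a) *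
  'C(3 * n - (3 * k1 + a), j) * ((3 * n - (3 * k1 + a) - j) %% 3 == c))) //.
apply: eq_bigr => k2 _; have [le_n | lt_n] := leqP (k1 + k2 + d) n.
  (* the only solution is k3 = n - (k1 + k2 + d) *)
  have lt_k3 : n - (k1 + k2 + d) < n.+1 by lia.
  rewrite (big_pred1 (Ordinal lt_k3)) => [|k3]; last first.
    by rewrite /= -val_eqE /=; apply/eqP/eqP; lia.
  rewrite trinomialE /=; set k3 := n - _.
  have -> : 3 * n - (3 * k1 + a) - (3 * k2 + b) = 3 * k3 + c by rewrite /k3; lia.
  rewrite mulnC [3 * k3]mulnC modnMDl modn_small // eqxx mul1n.
  by congr ('C(_, _) * 'C(_, _)); rewrite /k3; lia.
(* no k3 is left, and as c < 3 the two chosen multiplicities exceed 3n *)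
rewrite [RHS]big_pred0 => [|k3]; last by apply/eqP; lia.
have [lt1 | le1] := ltnP (3 * n) (3 * k1 + a); first by rewrite bin_small.
by rewrite [X in _ * X * _]bin_small ?muln0 //; lia.
Qed.

Lemma modn3S i : i.+1 %% 3 = nth 0 [:: 1; 2; 0] (i %% 3).
Proof.
rewrite -addn1 -modnDml; have := ltn_pmod i (isT : 0 < 3).
by case: (i %% 3) => [|[|[]]].
Qed.

Lemma tsum3S n F :
  tsum (3 * n.+1) F = tsum (3 * n) (shift (shift (shift F))).
Proof. by rewrite mulnS addnC addn3 !tsumS. Qed.

(** Both sides of the identities below depend on i, j, k through their residues
modulo 3 only, which leaves 27 cases to evaluate. *)
Ltac residues i j k :=
  rewrite /shift /cls012 /cls !modn3S;
  case: (i %% 3) (ltn_pmod i (isT : 0 < 3)) => [|[|[|//]]] _;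
  case: (j %% 3) (ltn_pmod j (isT : 0 < 3)) => [|[|[|//]]] _;
  case: (k %% 3) (ltn_pmod k (isT : 0 < 3)) => [|[|[|//]]] _.

Lemma shift3_cls000 i j k : shift (shift (shift (cls 0 0 0))) i j k
  = 3 * cls 0 0 0 i j k + 6 * cls 2 2 2 i j k + 3 * cls012 i j k.
Proof. by residues i j k. Qed.

Lemma shift3_cls111 i j k : shift (shift (shift (cls 1 1 1))) i j k
  = 3 * cls 1 1 1 i j k + 6 * cls 0 0 0 i j k + 3 * cls012 i j k.
Proof. by residues i j k. Qed.

Lemma shift3_cls222 i j k : shift (shift (shift (cls 2 2 2))) i j k
  = 3 * cls 2 2 2 i j k + 6 * cls 1 1 1 i j k + 3 * cls012 i j k.
Proof. by residues i j k. Qed.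

(** From a class with i + j + k divisible by 3, exactly 18 of the 27 words of
three letters lead to a permutation of (0,1,2).  Starting on the diagonal these
are the words with two distinct letters; starting off the diagonal, a diagonal
class is reached by 3 of the 6 displacements of type X^2 Y, each realised by
3 words, and the other 27 - 9 words remain. *)
Lemma shift3_cls012 i j k : shift (shift (shift cls012)) i j k
  = 18 * (cls 0 0 0 i j k + cls 1 1 1 i j k + cls 2 2 2 i j k + cls012 i j k).
Proof. by residues i j k. Qed.

(** * The recurrences *)

Lemma CA_tsum n : CA n = tsum (3 * n) (cls 0 0 0).
Proof.
rewrite (@tsum_cls 0 0 0 0) //; apply: eq_bigr => k1 _; apply: eq_bigr => k2 _.
by apply: eq_big => [k3|k3 _]; rewrite !addn0.
Qed.

Lemma CB_tsum n : CB n = tsum (3 * n) (cls 1 1 1).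
Proof. by rewrite (@tsum_cls 1 1 1 1). Qed.

Lemma CC_tsum n : CC n = tsum (3 * n) (cls 2 2 2).
Proof. by rewrite (@tsum_cls 2 2 2 2). Qed.

(** The factor 6 of [CD] is spread over the six permutations of (0,1,2), whose
trinomial sums agree by symmetry. *)
Lemma CD_tsum n : CD n = tsum (3 * n) cls012.
Proof.
have -> : CD n = 6 * tsum (3 * n) (cls 0 1 2).
  rewrite (@tsum_cls 0 1 2 1) //; congr (_ * _).
  do 2!apply: eq_bigr => ? _; by apply: eq_bigr => k3 _; rewrite addn0.
have swap12 a b c : tsum (3 * n) (cls b a c) = tsum (3 * n) (cls a b c).
  by rewrite -tsum_swap12; apply: eq_tsum => i j k; rewrite /cls; lia.
have swap23 a b c : tsum (3 * n) (cls a c b) = tsum (3 * n) (cls a b c).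
  by rewrite -tsum_swap23; apply: eq_tsum => i j k; rewrite /cls; lia.
rewrite /cls012 !tsumD [tsum _ (cls 2 1 0)]swap12 [tsum _ (cls 1 2 0)]swap23.
rewrite [tsum _ (cls 2 0 1)]swap12 [tsum _ (cls 1 0 2)]swap12.
rewrite [tsum _ (cls 0 2 1)]swap23; lia.
Qed.

Lemma CA_rec n : CA n.+1 = 3 * CA n + 6 * CC n + 3 * CD n.
Proof.
rewrite !(CA_tsum, CC_tsum, CD_tsum) tsum3S (eq_tsum _ _ _ shift3_cls000).
by rewrite 2!tsumD !tsumZ.
Qed.

Lemma CB_rec n : CB n.+1 = 3 * CB n + 6 * CA n + 3 * CD n.
Proof.
rewrite !(CA_tsum, CB_tsum, CD_tsum) tsum3S (eq_tsum _ _ _ shift3_cls111).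
by rewrite 2!tsumD !tsumZ.
Qed.

Lemma CC_rec n : CC n.+1 = 3 * CC n + 6 * CB n + 3 * CD n.
Proof.
rewrite !(CB_tsum, CC_tsum, CD_tsum) tsum3S (eq_tsum _ _ _ shift3_cls222).
by rewrite 2!tsumD !tsumZ.
Qed.

Lemma CD_rec n : CD n.+1 = 18 * (CA n + CB n + CC n + CD n).
Proof.
rewrite !(CA_tsum, CB_tsum, CC_tsum, CD_tsum) tsum3S.
by rewrite (eq_tsum _ _ _ shift3_cls012) tsumZ 3!tsumD.
Qed.

(** * Generating functions *)

Local Open Scope ring_scope.

Lemma genfunD (u v : nat -> nat) :
  genfun (fun n => (u n + v n)%N) = genfun u + genfun v.
Proof. by apply: fpsP => n; rewrite /= natrD. Qed.

Lemma genfunZ (c : nat) (u : nat -> nat) :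
  genfun (fun n => (c * u n)%N) = c%:R * genfun u.
Proof.
rewrite mulr_natl; elim: c => [|c IHc]; first by apply: fpsP.
by rewrite mulrS -IHc -genfunD.
Qed.

Lemma genfun_rec (u v : nat -> nat) : (forall n, u n.+1 = v n) ->
  genfun u = (u 0%N)%:R + fpsX rat * genfun v.
Proof.
move=> uS; apply: fpsP => n; rewrite fps_coefD fps_coefM.
have -> : ((u 0%N)%:R : fps rat) n = (u 0%N)%:R * (n == 0%N)%:R.
  elim: (u 0%N) => [|c IHc]; first by rewrite mul0r.
  by rewrite -!natr1 fps_coefD IHc mulrDl mul1r.
case: n => [|n]; first by rewrite big_ord1 mul0r addr0 mulr1.
rewrite mulr0 add0r big_ord_recl mul0r add0r big_ord_recl /= mul1r subSS subn0.
rewrite uS big1 ?addr0 // => i _; by rewrite mul0r.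
Qed.

Lemma fps_divP (f g h : fps rat) : g 0%N != 0 -> f * g = h -> f = h / g.
Proof. by move=> g0 <-; rewrite mulrK // fps_unitE unitfE. Qed.

Lemma genfun_CA : genfun CA
  = 1 + fpsX rat * (3 * genfun CA + 6 * genfun CC + 3 * genfun CD).
Proof.
by rewrite {1}(genfun_rec _ _ CA_rec) 2!genfunD 3!genfunZ CA_tsum tsum0.
Qed.

Lemma genfun_CB : genfun CB
  = fpsX rat * (3 * genfun CB + 6 * genfun CA + 3 * genfun CD).
Proof.
by rewrite {1}(genfun_rec _ _ CB_rec) 2!genfunD 3!genfunZ CB_tsum tsum0 add0r.
Qed.

Lemma genfun_CC : genfun CC
  = fpsX rat * (3 * genfun CC + 6 * genfun CB + 3 * genfun CD).
Proof.
by rewrite {1}(genfun_rec _ _ CC_rec) 2!genfunD 3!genfunZ CC_tsum tsum0 add0r.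
Qed.

Lemma genfun_CD : genfun CD
  = fpsX rat * (18 * (genfun CA + genfun CB + genfun CC + genfun CD)).
Proof.
by rewrite {1}(genfun_rec _ _ CD_rec) genfunZ 3!genfunD CD_tsum tsum0 add0r.
Qed.

(** Cramer's rule for a 4 by 4 system of determinant (1 - 27x)(1 + 27x^2).  The
block of a, b, c is circulant and the column of d is constant on it, so the
rows of the adjugate that give a, b, c are cyclic shifts of (p, q, r) followed
by s, with p, q, r, s as below. *)
Lemma linear_system (R : comNzRingType) (x a b c d : R) :
    a = 1 + x * (3 * a + 6 * c + 3 * d) ->
    b = x * (3 * b + 6 * a + 3 * d) ->
    c = x * (3 * c + 6 * b + 3 * d) ->
    d = x * (18 * (a + b + c + d)) ->
  [/\ a * ((1 - 27 * x) * (1 + 27 * x ^+ 2))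
        = 1 - 24 * x + 9 * x ^+ 2 - 162 * x ^+ 3,
      b * ((1 - 27 * x) * (1 + 27 * x ^+ 2))
        = 6 * x - 72 * x ^+ 2 - 162 * x ^+ 3,
      c * ((1 - 27 * x) * (1 + 27 * x ^+ 2)) = 90 * x ^+ 2 - 162 * x ^+ 3
    & d * (1 - 27 * x) = 18 * x].
Proof.
move=> Ea Eb Ec Ed.
(* za, zb, zc, zd are the residuals of the four equations; the two sides of
   each claim differ by a combination of them. *)
pose za := a - (1 + x * (3 * a + 6 * c + 3 * d)).
pose zb := b - x * (3 * b + 6 * a + 3 * d).
pose zc := c - x * (3 * c + 6 * b + 3 * d).
pose zd := d - x * (18 * (a + b + c + d)).
have za0 : za = 0 by rewrite /za -Ea subrr.
have zb0 : zb = 0 by rewrite /zb -Eb subrr.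
have zc0 : zc = 0 by rewrite /zc -Ec subrr.
have zd0 : zd = 0 by rewrite /zd -Ed subrr.
have combine u k1 k2 k3 k4 : u = u + k1 * za + k2 * zb + k3 * zc + k4 * zd.
  by rewrite za0 zb0 zc0 zd0 !mulr0 !addr0.
pose p := 1 - 24 * x + 9 * x ^+ 2 - 162 * x ^+ 3.
pose q := 90 * x ^+ 2 - 162 * x ^+ 3.
pose r := 6 * x - 72 * x ^+ 2 - 162 * x ^+ 3.
pose s := 3 * x + 81 * x ^+ 3.
split.
- by rewrite [RHS](combine _ p q r s) /za /zb /zc /zd /p /q /r /s; ring.
- by rewrite [RHS](combine _ r p q s) /za /zb /zc /zd /p /q /r /s; ring.
- by rewrite [RHS](combine _ q r p s) /za /zb /zc /zd /p /q /r /s; ring.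
(* here the factor 1 + 27x^2 cancels from the row of the adjugate *)
rewrite [RHS](combine _ (18 * x) (18 * x) (18 * x) (1 - 9 * x)) /za /zb /zc /zd.
ring.
Qed.

Theorem mainTheorem2 :
  let x : fps rat := fpsX rat in
  [/\ genfun CA = (162 * x ^+ 3 - 9 * x ^+ 2 + 24 * x - 1)
                  / ((27 * x - 1) * (27 * x ^+ 2 + 1)),
      genfun CB = 6 * x * (27 * x ^+ 2 + 12 * x - 1)
                  / ((27 * x - 1) * (27 * x ^+ 2 + 1)),
      genfun CC = 18 * x ^+ 2 * (5 - 9 * x)
                  / ((1 - 27 * x) * (1 + 27 * x ^+ 2))
    & genfun CD = 18 * x / (1 - 27 * x)].
Proof.
move=> x.
have [Ea Eb Ec Ed] :=
  @linear_system _ x _ _ _ _ genfun_CA genfun_CB genfun_CC genfun_CD.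
have x0 : x 0%N = 0 by [].
have coef0 := (fps_coefM0, fps_coefD, fps_coefN, fps_coef1, x0, expr2, mulr0).
split; apply: fps_divP; do 1?by rewrite !coef0.
- transitivity (- (genfun CA * ((1 - 27 * x) * (1 + 27 * x ^+ 2)))); first ring.
  by rewrite Ea; ring.
- transitivity (- (genfun CB * ((1 - 27 * x) * (1 + 27 * x ^+ 2)))); first ring.
  by rewrite Eb; ring.
- by rewrite Ec; ring.
exact: Ed.
Qed.
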